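(* Let $X\in\mathbb{R}^{H\times W\times C}$ and let $Z=A\odot V$ be the output of the Conv2Former block, where $A=\mathrm{DConv}_{k\times k}(W_1X)$ and $V=W_2X$. Then each entry of $Z$ is a homogeneous polynomial of degree $2$ in the entries of $X$; explicitly, for each spatial position $(i,j)$ and channel $k$, $$[Z]_{i,j,k}=\sum_{m,n}\sum_{s,t}\left([W_2]_{(i,j),(s,t)}\sum_{p,q}\mathsf{C}_{i-p,j-q,k}\,[W_1]_{(p,q),(m,n)}\right)X_{m,n,k}\,X_{s,t,k},$$ where $(m,n)$, $(s,t)$ and $(p,q)$ range over the spatial positions $\{1,\dots,H\}\times\{1,\dots,W\}$.
   Context: $\odot$ is the Hadamard (entrywise) product. $W_1$ and $W_2$ are real weight matrices with rows and columns indexed by spatial positions, acting by $[W_\ell X]_{i,j,k}=\sum_{s,t}[W_\ell]_{(i,j),(s,t)}X_{s,t,k}$ for $\ell=1,2$. $\mathrm{DConv}_{k\times k}$ is a depthwise convolution: with real kernel tensor $\mathsf{C}$ (extended by $0$ outside its support), $[\mathrm{DConv}_{k\times k}(U)]_{i,j,k}=\sum_{p,q}\mathsf{C}_{i-p,j-q,k}\,U_{p,q,k}$. (The kernel size $k$ in the name $\mathrm{DConv}_{k\times k}$ is unrelated to the channel index $k$.) The zero polynomial is counted as homogeneous of every degree. *)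

(* Defs.v *)
From mathcomp Require Import all_boot all_order all_algebra.
From mathcomp Require Import reals.
From mathcomp Require Import mpoly.

Set Implicit Arguments.
Unset Strict Implicit.
Unset Printing Implicit Defensive.

Import GRing.Theory.
Local Open Scope ring_scope.

(* H x W x C tensors, with indices counted from 0. *)
Definition tensor (R : Type) (H W C : nat) : Type := 'I_H -> 'I_W -> 'I_C -> R.

Definition hadamard (R : realType) (H W C : nat) (A V : tensor R H W C) :
    tensor R H W C :=
  fun i j k => A i j k * V i j k.

(* A matrix indexed by spatial positions is an (H * W) x (H * W) matrix, the
   position (i, j) being numbered by [mxvec_index i j]. *)
Definition wentry (R : realType) (H W : nat) (M : 'M[R]_(H * W))
    (i : 'I_H) (j : 'I_W) (s : 'I_H) (t : 'I_W) : R :=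
  M (mxvec_index i j) (mxvec_index s t).

Definition spatial_mul (R : realType) (H W C : nat) (M : 'M[R]_(H * W))
    (X : tensor R H W C) : tensor R H W C :=
  fun i j k => \sum_(s < H) \sum_(t < W) wentry M i j s t * X s t k.

Definition int_ord (n : nat) (z : int) : option 'I_n :=
  if z is Posz m then insub m else None.

(* Extension by 0 to all integer offsets of a kernel with a K x K window per
   channel. The stored entry (a, b) sits at the offset (a - o1, b - o2); for
   odd K, the centred window is o1 = o2 = (K - 1) / 2. *)
Definition kernel_ext (R : realType) (K C : nat) (o1 o2 : int)
    (ker : tensor R K K C) (u v : int) (k : 'I_C) : R :=
  match int_ord K (u + o1), int_ord K (v + o2) with
  | Some a, Some b => ker a b k
  | _, _ => 0
  end.

Definition dconv (R : realType) (H W C K : nat) (o1 o2 : int)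
    (ker : tensor R K K C) (U : tensor R H W C) : tensor R H W C :=
  fun i j k => \sum_(p < H) \sum_(q < W)
    kernel_ext o1 o2 ker (i%:Z - p%:Z) (j%:Z - q%:Z) k * U p q k.

Definition conv2former (R : realType) (H W C K : nat) (o1 o2 : int)
    (ker : tensor R K K C) (W1 W2 : 'M[R]_(H * W)) (X : tensor R H W C) :
    tensor R H W C :=
  hadamard (dconv o1 o2 ker (spatial_mul W1 X)) (spatial_mul W2 X).

(* The entries of X, as a valuation of the variables of a polynomial with one
   variable per index (i, j, k). *)
Definition entries (R : realType) (H W C : nat) (X : tensor R H W C) :
    'I_#|{: 'I_H * 'I_W * 'I_C}| -> R :=
  fun v => let: (i, j, k) := enum_val v in X i j k.

(* Main.v *)
Require Import Defs.
From mathcomp Require Import all_boot all_order all_algebra.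
From mathcomp Require Import reals.
From mathcomp Require Import mpoly.

Import GRing.Theory.
Local Open Scope ring_scope.

(** With the weights and the kernel fixed, [A] and [V] are both linear in [X] and act within each
    channel. An entry of their Hadamard product is thus a product of two linear forms in channel [k]
    of [X]. [dconv_spatial_mul] gives the coefficients of the form for [A]; distributing the product
    gives [conv2former_expansion]. Reading its right-hand side with variables in place of the
    entries of [X] gives the homogeneous polynomial. *)

(** A composite of linear maps has the product of their matrices: swapping the finite sums over
    [(p, q)] and [(m, n)] collects the coefficient of each [X m n k]. *)
Lemma dconv_spatial_mul (R : realType) (H W C K : nat) (o1 o2 : int)
    (ker : tensor R K K C) (M : 'M[R]_(H * W)) (X : tensor R H W C)
    (i : 'I_H) (j : 'I_W) (k : 'I_C) :
  dconv o1 o2 ker (spatial_mul M X) i j k =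
  \sum_(m < H) \sum_(n < W)
    (\sum_(p < H) \sum_(q < W)
      kernel_ext o1 o2 ker (i%:Z - p%:Z) (j%:Z - q%:Z) k * wentry M p q m n) *
    X m n k.
Proof.
rewrite /dconv /spatial_mul !pair_bigA /=.
under eq_bigr => a _ do rewrite pair_bigA mulr_sumr.
rewrite exchange_big; apply: eq_bigr => b _ /=.
rewrite pair_bigA mulr_suml; apply: eq_bigr => a _ /=.
by rewrite mulrA.
Qed.

Lemma conv2former_expansion (R : realType) (H W C K : nat) (o1 o2 : int)
    (ker : tensor R K K C) (W1 W2 : 'M[R]_(H * W)) (X : tensor R H W C)
    (i : 'I_H) (j : 'I_W) (k : 'I_C) :
  conv2former o1 o2 ker W1 W2 X i j k =
  \sum_(m < H) \sum_(n < W) \sum_(s < H) \sum_(t < W)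
    (wentry W2 i j s t *
     \sum_(p < H) \sum_(q < W)
       kernel_ext o1 o2 ker (i%:Z - p%:Z) (j%:Z - q%:Z) k *
       wentry W1 p q m n) *
    X m n k * X s t k.
Proof.
rewrite /conv2former /hadamard dconv_spatial_mul /spatial_mul.
rewrite mulr_suml; apply: eq_bigr => m _.
rewrite mulr_suml; apply: eq_bigr => n _.
rewrite mulr_sumr; apply: eq_bigr => s _.
rewrite mulr_sumr; apply: eq_bigr => t _.
by rewrite mulrCA !mulrA.
Qed.

Lemma entries_enum_rank (R : realType) (H W C : nat) (X : tensor R H W C)
    (i : 'I_H) (j : 'I_W) (k : 'I_C) :
  entries X (enum_rank (i, j, k)) = X i j k.
Proof. by rewrite /entries enum_rankK. Qed.

Theorem mainTheorem6 (R : realType) (H W C K : nat) (o1 o2 : int)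
    (ker : tensor R K K C) (W1 W2 : 'M[R]_(H * W))
    (i : 'I_H) (j : 'I_W) (k : 'I_C) :
  (exists2 P : {mpoly R[#|{: 'I_H * 'I_W * 'I_C}|]},
     P \is 2.-homog &
     forall X : tensor R H W C,
       conv2former o1 o2 ker W1 W2 X i j k = P.@[entries X]) /\
  (forall X : tensor R H W C,
     conv2former o1 o2 ker W1 W2 X i j k =
     \sum_(m < H) \sum_(n < W) \sum_(s < H) \sum_(t < W)
       (wentry W2 i j s t *
        \sum_(p < H) \sum_(q < W)
          kernel_ext o1 o2 ker (i%:Z - p%:Z) (j%:Z - q%:Z) k *
          wentry W1 p q m n) *
       X m n k * X s t k).
Proof.
split; last by move=> X; exact: conv2former_expansion.
pose x (m : 'I_H) (n : 'I_W) : {mpoly R[#|{: 'I_H * 'I_W * 'I_C}|]} :=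
  'X_(enum_rank (m, n, k)).
(* The witness depends only on the weights and the kernel, so one polynomial serves every [X]. *)
exists (\sum_(m < H) \sum_(n < W) \sum_(s < H) \sum_(t < W)
  (wentry W2 i j s t *
   \sum_(p < H) \sum_(q < W)
     kernel_ext o1 o2 ker (i%:Z - p%:Z) (j%:Z - q%:Z) k *
     wentry W1 p q m n) *: (x m n * x s t)).
  (* Homogeneous polynomials of degree 2 form a submodule, zero included, so vanishing coefficients
     do no harm; each monomial is a product of two variables, of degree 1 + 1. *)
  do 4![apply: rpred_sum => ? _].
  by rewrite rpredZ // (dhomogM (d := 1) (e := 1)) // /x dhomogX /= mdeg1.
move=> X; rewrite conv2former_expansion.
(* Evaluation is additive, so the two sides are compared term by term. *)
do 4![rewrite raddf_sum; apply: eq_bigr => ? _].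
by rewrite /= mevalZ mevalM !mevalXU !entries_enum_rank mulrA.
Qed.
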